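(* For any integer $r\ge 2$ and any $\epsilon>0$ there exists an infinite $\mathcal L^{(r)}_{2,\dots,2}$-free sequence $A$ of positive integers with $$A(x)\gg x^{1-\frac{r}{2^r-1}-\epsilon},$$ that is, there are constants $c>0$ and $x_0$ such that $A(x)\ge c\,x^{1-\frac{r}{2^r-1}-\epsilon}$ for all $x\ge x_0$.
   Context: A set $A$ of integers is called $\mathcal L^{(r)}_{2,\dots,2}$-free if $A$ contains no sumset (Hilbert cube of dimension $r$) $L_1+\cdots+L_r=\{\lambda_1+\cdots+\lambda_r:\lambda_i\in L_i\}$ with $L_i\subset\mathbb Z$ and $|L_1|=\cdots=|L_r|=2$ (the sums need not be pairwise distinct). An infinite sequence of positive integers is regarded as an infinite set $A$ of positive integers, and $A(x)=|A\cap[1,x]|$ is its counting function. *)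

(* Defs.v *)
From mathcomp Require Import all_boot all_order all_algebra.
From mathcomp Require Import finmap.
From mathcomp Require Import boolp classical_sets functions cardinality.
From mathcomp Require Import reals exp.

Set Implicit Arguments.
Unset Strict Implicit.
Unset Printing Implicit Defensive.

Import Order.TTheory GRing.Theory Num.Theory.

Local Open Scope classical_set_scope.
Local Open Scope ring_scope.

Definition sumset (r : nat) (L : 'I_r -> {fset int}) : set int :=
  [set s | exists lam : 'I_r -> int,
     (forall i, lam i \in L i) /\ s = \sum_(i < r) lam i].

(* The 2 ^ r sums are not required to be pairwise distinct. *)
Definition hilbert_cube_free (r : nat) (A : set int) : Prop :=
  forall L : 'I_r -> {fset int},
    (forall i, #|` L i| = 2%N) -> ~ (sumset L `<=` A).

(* [fset_set] is the empty set on infinite sets; the set below is always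
   finite, so the value is the genuine cardinality. *)
Definition counting (R : realType) (A : set int) (x : R) : nat :=
  #|` fset_set (A `&` [set n : int | (1 : R) <= n%:~R <= x])|.

(* Main.v *)
Require Import Defs.
From mathcomp Require Import all_boot all_order all_algebra.
From mathcomp Require Import finmap zify ring lra.
From mathcomp Require Import boolp classical_sets functions cardinality.
From mathcomp Require Import reals exp.

(** Why the theorem holds.

    Suppose that integers of size X are selected with probability X^(-beta). A
    cube given by a base point and [r] steps of size X whose 2^r sums are
    distinct survives with probability X^(-2^r beta), and there are X^(r+1) such
    cubes, so about X^(r + 1 - 2^r beta) of them survive. This is smaller than
    the number X^(1 - beta) of selected integers as soon as beta exceeds
    r / (2^r - 1), and then deleting one element of each cube costs little.

    Cubes whose sums are not distinct would spoil the count, because they have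
    fewer parameters but also fewer elements. Every such cube contains a
    three-term arithmetic progression ([uniq_cube]), so the selection is made
    inside a progression-free set. Behrend's construction ([behrend]) provides
    one of density X^(-o(1)) in an interval at each scale Q^K, and these
    intervals can be placed so that their union is still progression-free
    ([ap3_free_blocks]).

    Cubes may spread over several scales. With the steps sorted, the sums with a
    given largest step are at least as large as that step, which bounds the
    survival probability ([cube_weight]); the decrease of t / (2^t - 1) for
    t <= r ensures that cubes of full size dominate, and the expected number of
    cubes with largest element at scale K stays far below the size of the block
    ([expected_cubes]).

    The selection takes one element in each of disjoint groups of equal size, so
    the size of each block is fixed and first moments suffice. The random choices
    at all the infinitely many scales are fixed one scale after the other, by
    keeping a conditional expectation small ([derandomisation]). Deleting the
    largest element of each surviving cube leaves half of every block
    ([cube_free_set]). *)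

Set Implicit Arguments.
Unset Strict Implicit.
Unset Printing Implicit Defensive.

Import Order.TTheory GRing.Theory Num.Theory.

(** * Cubes and three-term progressions *)

(** The sums a + sum of a subset of [ds], listed along the choices of the
    subset. The recursion on the head of [ds] is what the weight estimates use:
    when [ds] is decreasing, every member of the second half is at least the
    largest step [d]. *)
Fixpoint cube (a : nat) (ds : seq nat) : seq nat :=
  if ds is d :: ds' then cube a ds' ++ cube (a + d) ds' else [:: a].

Definition ap3_free (V : nat -> Prop) : Prop :=
  forall x y z, V x -> V y -> V z -> x + z = y.*2 -> x = y.

Lemma size_cube a ds : size (cube a ds) = 2 ^ size ds.
Proof.
elim: ds a => //= d ds IH a.
by rewrite size_cat !IH addnn expnS mul2n.
Qed.

Lemma cube_shift a ds : cube a ds = [seq a + x | x <- cube 0 ds].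
Proof.
elim: ds a => [|d ds IH] a /=; first by rewrite addn0.
rewrite map_cat add0n -IH; congr (_ ++ _).
by rewrite (IH (a + d)) (IH d) -map_comp; apply: eq_map => x /=; rewrite addnA.
Qed.

Lemma mem_cube_base a ds : a \in cube a ds.
Proof. by elim: ds a => [|d ds IH] a /=; rewrite ?mem_head // mem_cat IH. Qed.

Lemma mem_cube_top a ds : a + sumn ds \in cube a ds.
Proof.
elim: ds a => [|d ds IH] a /=; first by rewrite addn0 mem_head.
by rewrite mem_cat addnA IH orbT.
Qed.

Lemma cube_bounds a ds x : x \in cube a ds -> a <= x <= a + sumn ds.
Proof.
elim: ds a => [|d ds IH] a /=; first by rewrite inE addn0 => /eqP->; rewrite leqnn.
by rewrite mem_cat => /orP[] /IH; lia.
Qed.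

(** Removing the common part from two subsets makes them disjoint, so that
    their union is a subset too: this is why [x' + y'] is again a subset sum. *)
Lemma subset_sums_cancel ds x y : x \in cube 0 ds -> y \in cube 0 ds ->
  exists c x' y', [/\ x = x' + c, y = y' + c, x' \in cube 0 ds,
    y' \in cube 0 ds & x' + y' \in cube 0 ds].
Proof.
elim: ds x y => [|d ds IH] x y /=.
  by rewrite !inE => /eqP-> /eqP->; exists 0, 0, 0.
have addd z : z \in cube 0 ds -> d + z \in cube d ds.
  by move=> hz; rewrite (cube_shift d); apply/map_f.
rewrite add0n !mem_cat (cube_shift d) => /orP[hx|/mapP[x1 hx ->]] /orP[hy|/mapP[y1 hy ->]].
- have [c [x' [y' [-> -> h1 h2 h3]]]] := IH _ _ hx hy.
  by exists c, x', y'; split; rewrite // mem_cat ?h1 ?h2 ?h3.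
- have [c [x' [y' [-> -> h1 h2 h3]]]] := IH _ _ hx hy.
  exists c, x', (d + y'); split; rewrite ?mem_cat -?cube_shift ?h1 ?(addd _ h2) ?orbT //; first lia.
  by rewrite addnCA (addd _ h3) orbT.
- have [c [x' [y' [-> -> h1 h2 h3]]]] := IH _ _ hx hy.
  exists c, (d + x'), y'; split; rewrite ?mem_cat -?cube_shift ?h2 ?(addd _ h1) ?orbT //; first lia.
  by rewrite -addnA (addd _ h3) orbT.
- have [c [x' [y' [-> -> h1 h2 h3]]]] := IH _ _ hx hy.
  exists (d + c), x', y'; split; rewrite ?mem_cat ?h1 ?h2 ?h3 //; lia.
Qed.

(** A coincidence among the [2 ^ size ds] sums of a cube gives, after removing
    common steps, two disjoint nonempty sets of steps with the same sum [D > 0];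
    then a, a + D and a + 2D all belong to the cube. *)
Lemma uniq_cube V a ds : ap3_free V -> all (leq 1) ds ->
  (forall x, x \in cube a ds -> V x) -> uniq (cube a ds).
Proof.
move=> V3; elim: ds a => //= d ds IH a /andP[d0 ds0] inV.
have inV1 x : x \in cube a ds -> V x by move=> h; apply: inV; rewrite mem_cat h.
have inV2 x : x \in cube (a + d) ds -> V x.
  by move=> h; apply: inV; rewrite mem_cat h orbT.
rewrite cat_uniq IH //= IH // andbT.
apply/hasPn => v /=; rewrite cube_shift => /mapP[y hy ->].
apply/negP; rewrite cube_shift => /mapP[x hx e].
have [c [x' [y' [ex ey h1 h2 h3]]]] := subset_sums_cancel hx hy.
have : a = a + x'.
  apply: (V3 _ _ (a + d + (x' + y'))); last by lia.
  - by apply: inV1; apply: mem_cube_base.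
  - by apply: inV1; rewrite cube_shift map_f.
  - by apply: inV2; rewrite (cube_shift (a + d)) map_f.
lia.
Qed.

(** * Behrend's dense sets without three-term progressions *)

Lemma digits_inj (B n : nat) (u v : 'I_n -> nat) :
  (forall i, u i < B) -> (forall i, v i < B) ->
  \sum_(i < n) u i * B ^ i = \sum_(i < n) v i * B ^ i -> u =1 v.
Proof.
elim: n u v => [|n IH] u v hu hv; first by move=> _ [].
have B0 : 0 < B by apply: leq_trans (hu ord0).
have split_low w : \sum_(i < n.+1) w i * B ^ i =
    (\sum_(i < n) w (lift ord0 i) * B ^ i) * B + w ord0.
  rewrite big_ord_recl /= expn0 muln1 addnC; congr (_ + _).
  rewrite big_distrl /=; apply: eq_bigr => i _.
  by rewrite -mulnA -expnSr.
rewrite !split_low => e.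
have e0 : u ord0 = v ord0.
  have := congr1 (modn ^~ B) e.
  by rewrite !modnMDl !modn_small.
have e1 : \sum_(i < n) u (lift ord0 i) * B ^ i =
          \sum_(i < n) v (lift ord0 i) * B ^ i.
  by apply/eqP; rewrite -(eqn_pmul2r B0); apply/eqP; move: e; rewrite e0 => /addIn.
move=> i; case: (unliftP ord0 i) => [j ->|-> //].
by apply: (IH (u \o lift ord0) (v \o lift ord0)) => // k; [apply: hu|apply: hv].
Qed.

Lemma digits_bound (B n : nat) (u : 'I_n -> nat) :
  (forall i, u i < B) -> \sum_(i < n) u i * B ^ i < B ^ n.
Proof.
elim: n u => [|n IH] u hu; first by rewrite big_ord0.
rewrite big_ord_recr /=.
have := IH (u \o widen_ord (leqnSn n)) (fun i => hu _).
have := hu ord_max; rewrite expnS /=; nia.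
Qed.

(** A line meets a sphere at most twice: the midpoint of two points of a sphere
    lies on it only if they coincide. *)
Lemma sphere_ap3 (n : nat) (x y z : 'I_n -> nat) :
  \sum_(i < n) x i ^ 2 = \sum_(i < n) y i ^ 2 ->
  \sum_(i < n) z i ^ 2 = \sum_(i < n) y i ^ 2 ->
  (forall i, x i + z i = (y i).*2) -> x =1 y.
Proof.
move=> ex ez e.
(* [dist i] is the square of [x i - y i], written with truncated subtractions *)
pose dist i := (x i - y i) ^ 2 + (y i - x i) ^ 2.
(* parallelogram law: x^2 + z^2 = 2 y^2 + 2 (x - y)^2 when x + z = 2 y *)
have h : \sum_(i < n) dist i = 0.
  have : \sum_(i < n) (x i ^ 2 + z i ^ 2) =
      \sum_(i < n) ((y i ^ 2).*2 + (dist i).*2).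
    by apply: eq_bigr => i _; have := e i; rewrite /dist; nia.
  rewrite !big_split /= ex ez.
  under [X in _ = X + _]eq_bigr => i _ do rewrite -addnn.
  under [X in _ = _ + X]eq_bigr => i _ do rewrite -addnn.
  rewrite !big_split /=; lia.
move/eqP: h; rewrite sum_nat_eq0 => /forallP h i.
have := h i; rewrite /dist /=; nia.
Qed.

(** Points of the grid {0, ..., 2^w - 1}^n on a common sphere, read as numbers
    in base 2^(w+1). The base is twice the range of the digits, so adding two
    such numbers produces no carry and an arithmetic progression of numbers is
    one of vectors. The squared radius takes at most n 4^w + 1 values. *)
Lemma behrend n w : exists W : seq nat,
  [/\ uniq W, ap3_free (fun x => x \in W),
      forall x, x \in W -> x < 2 ^ (n * w.+1)
    & 2 ^ (w * n) <= size W * (n * 4 ^ w).+1].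
Proof.
pose b := 2 ^ w.
pose T := {ffun 'I_n -> 'I_b}.
pose enc (f : T) := \sum_(i < n) (f i : nat) * (2 ^ w.+1) ^ i.
have ltB (f : T) i : f i < 2 ^ w.+1.
  by have := ltn_ord (f i); rewrite /b expnS; lia.
have encI : injective enc.
  move=> f g /digits_inj e; apply/ffunP => i; apply/val_inj.
  by apply: e => j; apply: ltB.
pose sq (f : T) := \sum_(i < n) (f i : nat) ^ 2.
have sqb f : sq f < (n * 4 ^ w).+1.
  rewrite ltnS -[X in _ <= X * _](card_ord n) -sum_nat_const leq_sum // => i _.
  have := ltn_ord (f i); rewrite /b (_ : 4 = 2 ^ 2) // -expnM mulnC expnM => h.
  by rewrite leq_exp2r // ltnW.
pose S t := [set f : T | sq f == t].
have [t ht] : exists t : 'I_(n * 4 ^ w).+1, 2 ^ (w * n) <= #|S t| * (n * 4 ^ w).+1.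
  apply/existsP; rewrite -[[exists _, _]]negbK negb_exists; apply/negP => /forallP hlt.
  have : #|T| = \sum_(t < (n * 4 ^ w).+1) #|S t|.
    rewrite -sum1_card (partition_big (fun f => Ordinal (sqb f)) xpredT) //=.
    by apply: eq_bigr => t _; rewrite -sum1_card; apply: eq_bigl => f; rewrite inE.
  rewrite card_ffun !card_ord /b -expnM => e.
  have : \sum_(t < (n * 4 ^ w).+1) #|S t| * (n * 4 ^ w).+1 <
         \sum_(t < (n * 4 ^ w).+1) 2 ^ (w * n).
    apply: (@leq_trans (\sum_(t < (n * 4 ^ w).+1) (#|S t| * (n * 4 ^ w).+1).+1)).
      rewrite -addn1; under [X in _ <= X]eq_bigr => t _ do rewrite -addn1.
      by rewrite big_split /= leq_add2l sum_nat_const card_ord muln1.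
    by apply: leq_sum => t _; rewrite ltnNge; apply: hlt.
  by rewrite sum_nat_const card_ord -big_distrl /= -e mulnC ltnn.
exists [seq enc f | f <- enum (S t)]; split.
- by rewrite map_inj_uniq // enum_uniq.
- move=> _ _ _ /mapP[x hx ->] /mapP[y hy ->] /mapP[z hz ->] e.
  move: hx hy hz; rewrite !mem_enum !inE => /eqP hx /eqP hy /eqP hz.
  congr enc; apply/ffunP => i; apply/val_inj.
  apply: (@sphere_ap3 _ (fun i => x i : nat) (fun i => y i : nat) (fun i => z i : nat)).
  + by rewrite -/(sq x) hx -hy.
  + by rewrite -/(sq z) hz -hy.
  have hlt2 (f g : T) j : f j + g j < 2 ^ w.+1.
    by have := ltn_ord (f j); have := ltn_ord (g j); rewrite /b expnS; lia.
  apply: (@digits_inj (2 ^ w.+1) _ (fun j => x j + z j) (fun j => (y j).*2)) => [j|j|].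
  + exact: hlt2.
  + by rewrite -addnn; apply: hlt2.
  move: e; rewrite /enc -muln2 big_distrl -big_split /= => e.
  under eq_bigr => j _ do rewrite mulnDl.
  by rewrite e; apply: eq_bigr => j _; rewrite -muln2 mulnAC.
- by move=> _ /mapP[f _ ->]; rewrite mulnC expnM; apply: digits_bound; apply: ltB.
- by rewrite size_map -cardE.
Qed.

(** * Random transversals *)

(** Each prescription [f i = c] divides the number of functions by [#|G|], or
    makes it zero when it contradicts another one. *)
Lemma card_prescribed (I G : finType) (S : seq (I * G)) : uniq S ->
  #|[set f : {ffun I -> G} | all (fun x => f x.1 == x.2) S]| * #|G| ^ size S
    <= #|G| ^ #|I|.
Proof.
elim: S => [|[i c] S IH] /=.
  move=> _; rewrite expn0 muln1 -card_ffun; exact: max_card.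
case/andP => nin /IH; apply: leq_trans; rewrite expnS mulnA leq_mul2r.
apply/orP; right.
set A := [set f | _]; set B := [set f | _].
(* resetting the value at [i] of a function obeying all prescriptions yields,
   injectively, functions obeying the remaining ones *)
pose upd (x : {ffun I -> G} * G) : {ffun I -> G} :=
  [ffun j => if j == i then x.2 else x.1 j].
rewrite -[#|G|]cardsT -cardsX -(@card_in_imset _ _ upd); last first.
  move=> [f c1] [g c2]; rewrite !inE /= !andbT.
  move=> /andP[/eqP fi _] /andP[/eqP gi _] e.
  have /= := congr1 (fun h : {ffun I -> G} => h i) e.
  rewrite !ffunE eqxx /= => ->; congr (_, _); apply/ffunP => j.
  have [->|ji] := eqVneq j i; first by rewrite fi gi.
  have /= := congr1 (fun h : {ffun I -> G} => h j) e.
  by rewrite !ffunE (negPf ji).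
apply/subset_leq_card/fintype.subsetP => _ /imsetP[[f c1] + ->].
rewrite !inE /= andbT => /andP[/eqP fi /allP fS].
apply/allP => -[j c2] jS; rewrite ffunE /=.
have := fS _ jS; rewrite /= => /eqP fj.
have [ji|ji] := eqVneq j i; last by rewrite fj.
(* a second prescription at [i] would have to be the first one again *)
by move: nin; rewrite -fi -ji fj jS.
Qed.

(** The values of [e] form #|I| groups of #|G| elements; picking one element in
    each group independently gives a random set of exactly #|I| elements that
    contains a given finite set [S] with probability at most #|G|^-|S|. The size
    of the random set being deterministic, only expectations are needed below,
    and no concentration bound. *)
Section Transversals.
Variables (I G : finType) (e : I * G -> nat).
Hypothesis e_inj : injective e.

Definition transversal (f : {ffun I -> G}) : seq nat :=
  [seq e (i, f i) | i <- enum I].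

Definition transversals : seq (seq nat) :=
  [seq transversal f | f <- enum {ffun I -> G}].

Lemma uniq_transversal f : uniq (transversal f).
Proof. by rewrite map_inj_uniq ?enum_uniq // => i j /e_inj[]. Qed.

Lemma size_transversal f : size (transversal f) = #|I|.
Proof. by rewrite size_map -cardE. Qed.

Lemma size_transversals : size transversals = #|G| ^ #|I|.
Proof. by rewrite size_map -cardE card_ffun. Qed.

Lemma count_transversals S : uniq S ->
  count (fun F => all (mem F) S) transversals * #|G| ^ size S
    <= size transversals.
Proof.
move=> uS; rewrite size_transversals.
pose S' := [seq x <- enum {: I * G} | e x \in S].
have S'E x : (x \in S') = (e x \in S) by rewrite mem_filter mem_enum andbT.
have uS' : uniq S' by rewrite filter_uniq // enum_uniq.
rewrite count_map.
set P := preim _ _.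
have PS f : P f -> all (fun x => f x.1 == x.2) S'.
  move=> /allP h; apply/allP => -[i c]; rewrite S'E => /h /mapP[j _].
  by move=> /e_inj[-> ->] /=.
have cE : count P (enum {ffun I -> G}) <=
    #|[set f : {ffun I -> G} | all (fun x => f x.1 == x.2) S']|.
  rewrite -size_filter cardE; apply: uniq_leq_size => [|f].
    by apply: filter_uniq; apply: enum_uniq.
  by rewrite mem_filter => /andP[/PS fS' _]; rewrite mem_enum inE.
have [/hasP[f _ Pf]|] := boolP (has P (enum {ffun I -> G})); last first.
  by rewrite has_count -eqn0Ngt => /eqP->.
have szS : size S <= size S'.
  rewrite -(size_map e) uniq_leq_size // => s sS.
  have /mapP[i _ es] := allP Pf _ sS.
  by apply/mapP; exists (i, f i) => //; rewrite S'E -es.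
(* comparing the powers of [#|G|] requires [G] to be inhabited, which a
   nonempty [S] contained in a transversal ensures *)
have [S0|S0] := posnP (size S).
  rewrite S0 muln1; apply: leq_trans (count_size _ _) _.
  by rewrite -cardE card_ffun.
have G0 : 0 < #|G|.
  have /mapP[i _ _] := allP Pf _ (mem_nth 0 S0).
  by apply/card_gt0P; exists (f i).
apply: leq_trans (card_prescribed uS').
by rewrite leq_mul // leq_pexp2l.
Qed.
End Transversals.

Local Open Scope ring_scope.

(** * Choosing all blocks by conditional expectations *)

(** The block chosen at scale [K] is uniformly distributed in [fam K], the
    choices at distinct scales are independent, and [Bs K] lists the bad
    configurations attributed to scale [K], which involve scales up to [K]
    only. If the sum over all scales of the weighted expected numbers of bad
    configurations is at most [theta], one infinite sequence of choices keeps
    each weighted number at most [theta]. *)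
Section Derandomisation.
Variables (R : realFieldType) (fam : nat -> seq (seq nat)) (l : nat -> nat).
Variables (p : nat -> R) (w : nat -> R) (Bs : nat -> seq (seq nat)) (theta : R).
Hypothesis p_ge0 : forall K, 0 <= p K.
Hypothesis w_ge0 : forall K, 0 <= w K.
Hypothesis fam_neq0 : forall K, fam K != [::].
Hypothesis fam_indep : forall K S, uniq S -> all (fun x => l x == K) S ->
  \sum_(F <- fam K) (all (mem F) S)%:R <= p K ^+ size S * (size (fam K))%:R.
Hypothesis Bs_uniq : forall K S, S \in Bs K -> uniq S.
Hypothesis Bs_scale : forall K S x, S \in Bs K -> x \in S -> (l x <= K)%N.

(** Bound on the probability that [S] is contained in the random set, given the
    choices [F] made at the scales below [n]. *)
Definition cond_prob (F : nat -> seq nat) (n : nat) (S : seq nat) : R :=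
  \prod_(x <- S) (if (l x < n)%N then (x \in F (l x))%:R else p (l x)).

Definition potential (F : nat -> seq nat) (n L : nat) : R :=
  \sum_(0 <= K < L) w K * \sum_(S <- Bs K) cond_prob F n S.

Definition set_at (F : nat -> seq nat) (n : nat) (G : seq nat) : nat -> seq nat :=
  fun k => if k == n then G else F k.

Lemma cond_prob_ge0 F n S : 0 <= cond_prob F n S.
Proof. by apply: prodr_ge0 => x _; case: ifP. Qed.

Lemma prod_indicator (T : Type) (P : pred T) (s : seq T) :
  \prod_(x <- s) (P x)%:R = (all P s)%:R :> R.
Proof.
elim: s => [|x s IH]; rewrite ?big_nil // big_cons IH /=.
by case: (P x); rewrite ?mul1r ?mul0r.
Qed.

(** On average over the choice at scale [n], deciding that scale does not
    increase the conditional bound. *)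
Lemma cond_prob_step F n S : uniq S ->
  \sum_(G <- fam n) cond_prob (set_at F n G) n.+1 S
    <= cond_prob F n S * (size (fam n))%:R.
Proof.
move=> uS.
pose rest := \prod_(x <- S | l x != n)
  (if (l x < n)%N then (x \in F (l x))%:R else p (l x)).
have rest_ge0 : 0 <= rest by apply: prodr_ge0 => x _; case: ifP.
pose Sn := [seq x <- S | l x == n].
have stepE G : cond_prob (set_at F n G) n.+1 S = (all (mem G) Sn)%:R * rest.
  rewrite /cond_prob (bigID (fun x => l x == n)) /=; congr (_ * _).
    rewrite -prod_indicator big_filter; apply: eq_bigr => x /eqP ->.
    by rewrite /set_at ltnSn eqxx.
  by apply: eq_bigr => x xn; rewrite /set_at (negPf xn) ltnS leq_eqVlt (negPf xn).
under eq_bigr => G _ do rewrite stepE.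
rewrite -mulr_suml.
have -> : cond_prob F n S = p n ^+ size Sn * rest.
  rewrite /cond_prob (bigID (fun x => l x == n)) /=; congr (_ * _).
  rewrite -big_filter -/Sn; have : all (fun x => l x == n) Sn by apply: filter_all.
  elim: (Sn) => [|x s IH] /=; rewrite ?big_nil ?big_cons //.
  by move=> /andP[/eqP lx /IH->]; rewrite exprS lx ltnn.
rewrite mulrAC; apply: ler_wpM2r => //.
by apply: fam_indep; rewrite ?filter_uniq ?filter_all.
Qed.

Lemma potential_step F n L :
  \sum_(G <- fam n) potential (set_at F n G) n.+1 L
    <= potential F n L * (size (fam n))%:R.
Proof.
rewrite exchange_big /= mulr_suml; apply: ler_sum => K _.
rewrite -mulr_sumr -mulrA ler_wpM2l // exchange_big /= mulr_suml.
rewrite big_seq [leRHS]big_seq; apply: ler_sum => S SB.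
by apply: cond_prob_step; apply: Bs_uniq SB.
Qed.

Lemma potential_mono F n : {homo potential F n : L M / (L <= M)%N >-> L <= M}.
Proof.
move=> L M LM; rewrite /potential (@big_cat_nat _ _ _ L 0 M) //= lerDl sumr_ge0 // => K _.
by rewrite mulr_ge0 // sumr_ge0 // => S _; apply: cond_prob_ge0.
Qed.

(** The bound is kept for all horizons [L] at once: if every choice failed at
    some horizon, all of them would fail at the largest of these finitely many
    horizons, since the potential increases with [L], contradicting the average
    [potential_step]. This replaces a compactness argument. *)
Lemma extend_choice F n : (forall L, potential F n L <= theta) ->
  exists2 G, G \in fam n & forall L, potential (set_at F n G) n.+1 L <= theta.
Proof.
move=> hF; apply: contrapT => hno.
have bad G : exists L, G \in fam n -> theta < potential (set_at F n G) n.+1 L.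
  have [Gf|] := boolP (G \in fam n); last by exists 0.
  apply: contrapT => h; apply: hno; exists G => // L.
  by rewrite leNgt; apply/negP => hlt; apply: h; exists L.
have [Lb hLb] := choice bad.
pose L := \max_(G <- fam n) Lb G.
have lt_pot G : G \in fam n -> theta < potential (set_at F n G) n.+1 L.
  move=> Gf; apply: lt_le_trans (hLb _ Gf) _; apply: potential_mono.
  by rewrite /L; apply: leq_bigmax_seq.
have := potential_step F n L; apply/negP; rewrite -ltNge.
apply: (@le_lt_trans _ _ (theta * (size (fam n))%:R)).
  by rewrite ler_wpM2r.
have -> : theta * (size (fam n))%:R = \sum_(G <- fam n) theta.
  by rewrite big_const_seq count_predT iter_addr_0 mulr_natr.
rewrite big_seq [ltRHS]big_seq; apply: ltr_sum => //.
case: (fam n) (fam_neq0 n) => // G s _.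
by apply/hasP; exists G; rewrite mem_head.
Qed.

Lemma derandomisation :
  (forall L, \sum_(0 <= K < L) w K * \sum_(S <- Bs K) \prod_(x <- S) p (l x) <= theta) ->
  exists F : nat -> seq nat, (forall K, F K \in fam K) /\
    forall K, w K * (count (all (fun x => x \in F (l x))) (Bs K))%:R <= theta.
Proof.
move=> start.
have step (Fn : (nat -> seq nat) * nat) : exists G,
    (forall L, potential Fn.1 Fn.2 L <= theta) -> G \in fam Fn.2 /\
    forall L, potential (set_at Fn.1 Fn.2 G) Fn.2.+1 L <= theta.
  have [h|h] := pselect (forall L, potential Fn.1 Fn.2 L <= theta); last by exists [::].
  by have [G Gf GL] := extend_choice h; exists G.
have [next hnext] := choice step.
pose st := fix st n := if n is m.+1 then set_at (st m) m (next (st m, m)) else fun=> [::].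
have stP n L : potential (st n) n L <= theta.
  elim: n L => [L|n IH L]; first by apply: le_trans (start L).
  by have [] := hnext (st n, n) IH.
pose F K := st K.+1 K.
have stF n k : (k < n)%N -> st n k = F k.
  elim: n => // n IH; rewrite ltnS leq_eqVlt => /orP[/eqP->//|kn].
  by rewrite -(IH kn) /= /set_at (ltn_eqF kn).
exists F; split=> K.
  rewrite /F /= /set_at eqxx.
  by have [] := hnext (st K, K) (stP K).
apply: le_trans (stP K.+1 K.+1).
rewrite /potential big_nat_recr //= -[leLHS]add0r lerD //.
  apply: sumr_ge0 => j _; rewrite mulr_ge0 // sumr_ge0 // => S _.
  exact: cond_prob_ge0.
rewrite ler_wpM2l // -sum1_count natr_sum big_mkcond /=.
rewrite big_seq [leRHS]big_seq; apply: ler_sum => S SB.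
suff -> : cond_prob (st K.+1) K.+1 S = (all (fun x => x \in F (l x)) S)%:R by case: all.
rewrite -prod_indicator /cond_prob big_seq [RHS]big_seq; apply: eq_bigr => x xS.
by rewrite ltnS (Bs_scale SB xS) stF // ltnS (Bs_scale SB xS).
Qed.
End Derandomisation.

(** * The expected number of cubes *)

Section PowersOfTwo.
Variable R : realFieldType.
Definition pow2 (z : int) : R := 2 ^ z.

Lemma pow2_gt0 z : 0 < pow2 z. Proof. exact: exprz_gt0. Qed.
Lemma pow2_ge0 z : 0 <= pow2 z. Proof. exact/ltW/pow2_gt0. Qed.
Lemma pow2D y z : pow2 (y + z) = pow2 y * pow2 z.
Proof. by rewrite /pow2 expfzDr // pnatr_eq0. Qed.
Lemma pow2_le y z : (pow2 y <= pow2 z) = (y <= z).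
Proof. by rewrite /pow2 ler_eXz2l // ltr1n. Qed.
Lemma pow2X z k : pow2 z ^+ k = pow2 (z * k%:Z).
Proof. by rewrite /pow2 exprnP exprz_exp. Qed.
Lemma pow2_nat k : pow2 k%:Z = (2 ^ k)%N%:R.
Proof. by rewrite natrX. Qed.
End PowersOfTwo.

Lemma prod_le_const (R : realFieldType) (T : eqType) (s : seq T) (f : T -> R) c :
  (forall x, x \in s -> 0 <= f x <= c) -> \prod_(x <- s) f x <= c ^+ size s.
Proof.
elim: s => [|x s IH] h; rewrite ?big_nil // big_cons exprS.
have /andP[fx0 fxc] := h x (mem_head x s).
apply: ler_pM => //; last by apply: IH => y ys; apply: h; rewrite inE ys orbT.
rewrite big_seq prodr_ge0 // => y ys.
have : y \in x :: s by rewrite inE ys orbT.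
by move=> /h /andP[].
Qed.

Lemma prod_ge_const (R : realFieldType) (T : eqType) (s : seq T) (f : T -> R) c :
  0 <= c -> (forall x, x \in s -> c <= f x) -> c ^+ size s <= \prod_(x <- s) f x.
Proof.
move=> c0; elim: s => [|x s IH] h; rewrite ?big_nil // big_cons exprS.
apply: ler_pM; rewrite ?exprn_ge0 //; first exact/h/mem_head.
by apply: IH => y ys; apply: h; rewrite inE ys orbT.
Qed.

Fixpoint tuples (t X : nat) : seq (seq nat) :=
  if t is t'.+1 then [seq d :: ds | d <- iota 1 X, ds <- tuples t' X]
  else [:: [::]].

Lemma mem_tuples t X ds :
  (ds \in tuples t X) = (size ds == t) && all (fun d => 1 <= d <= X)%N ds.
Proof.
elim: t ds => [|t IH] [|d ds] //=.
  by apply/allpairsP => -[[? ?] []].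
apply/allpairsP/andP => [[[d' ds'] /= [hd hds [-> ->]]]|[/eqP[sz] /andP[hd hds]]].
  move: hd hds; rewrite mem_iota IH => ? /andP[/eqP-> ->]; rewrite eqxx; lia.
by exists (d, ds); split; rewrite //= ?IH ?mem_iota ?sz ?eqxx //; lia.
Qed.

Lemma sum_tuples (R : realFieldType) (u : nat -> R) t X :
  \sum_(ds <- tuples t X) \prod_(d <- ds) u d = (\sum_(d <- iota 1 X) u d) ^+ t.
Proof.
elim: t => [|t IH] /=; first by rewrite big_seq1 big_nil.
rewrite big_allpairs_dep exprS mulr_suml; apply: eq_bigr => d _.
by rewrite -IH mulr_sumr; apply: eq_bigr => ds _; rewrite big_cons.
Qed.

(** Integers are grouped in scales [Q^K, Q^(K+1)) with Q = 2^n, and an integer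
    of scale [K] is selected with probability 2^(-sK). *)
Section Weights.
Variables (R : realFieldType) (n s r : nat).
Hypothesis n_ge3 : (3 <= n)%N.

Local Notation Q := (2 ^ n)%N.
Definition scale (x : nat) : nat := trunc_log (2 ^ n) x.
Definition prob (K : nat) : R := pow2 R (- (s * K)%N%:Z).

Lemma Q_ge8 : (8 <= Q)%N.
Proof. by rewrite (@leq_pexp2l 2 3). Qed.

Lemma Q_gt1 : (1 < Q)%N.
Proof. exact: leq_trans Q_ge8. Qed.

Lemma scale_le x y : (x <= y)%N -> (scale x <= scale y)%N.
Proof. exact: leq_trunc_log. Qed.

Lemma scale_lt x K : (scale x <= K)%N -> (x < Q ^ K.+1)%N.
Proof.
move=> h; apply: leq_trans (trunc_log_ltn _ Q_gt1) _.
by rewrite leq_exp2l ?Q_gt1.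
Qed.

Lemma scale_eq x K : (Q ^ K <= x < Q ^ K.+1)%N -> scale x = K.
Proof. exact: trunc_log_eq Q_gt1. Qed.

Lemma prob_ge0 K : 0 <= prob K. Proof. exact: pow2_ge0. Qed.

Lemma prob_le x y : (x <= y)%N -> prob (scale y) <= prob (scale x).
Proof. by move=> xy; rewrite /prob pow2_le lerN2 lez_nat leq_mul2l scale_le ?orbT. Qed.

(** The exponent t - (2^t - 1) s/n, multiplied by n: there are X^t choices of
    [t] steps of size X, and 2^t - 1 sums involving at least one of them, each
    selected with probability X^(-s/n). *)
Definition excess (t : nat) : int :=
  t%:Z * n%:Z - s%:Z * ((2 ^ t)%N%:Z - 1).

Lemma excessS t : excess t.+1 = excess t + n%:Z - s%:Z * (2 ^ t)%N%:Z.
Proof. rewrite /excess expnS PoszM intS; ring. Qed.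

Hypothesis excess_ge0 : forall t, (t < r)%N -> 0 <= excess t.

(** About 1/d: summed over [d] up to Q^K it is only of order K. *)
Definition density (d : nat) : R := pow2 R (- (n * scale d)%N%:Z).

(** Once the steps are sorted, the 2^i sums whose largest step is the (i+1)-th
    smallest one are at least that step, so they have at most its probability.
    The factor left besides the densities is a product of powers of the steps
    with partial exponent sums [excess t]; as these are nonnegative for [t < r],
    replacing each step by the next larger one accumulates everything on the
    largest step. *)
Lemma cube_weight a ds : (size ds <= r)%N -> sorted geq ds ->
  \prod_(x <- cube a ds) prob (scale x) <=
    prob (scale a) * \prod_(d <- ds) density d *
      pow2 R (excess (size ds) * (scale (head 0%N ds))%:Z).
Proof.
elim: ds a => [|d ds IH] a /=.
  by rewrite big_seq1 big_nil /excess mul0r subrr mulr0 subr0 mul0r !mulr1.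
move=> rds sds.
have sds' : sorted geq ds by apply: path_sorted sds.
have hd : (scale (head 0 ds) <= scale d)%N.
  apply: scale_le; case: (ds) sds => //= y ys /andP[]; rewrite /geq /=; lia.
rewrite big_cat big_cons /=.
have h1 := IH a (ltnW rds) sds'.
have h2 : \prod_(x <- cube (a + d) ds) prob (scale x) <= prob (scale d) ^+ (2 ^ size ds).
  rewrite -(size_cube (a + d)); apply: prod_le_const => x /cube_bounds/andP[ax _].
  by rewrite prob_ge0 prob_le //; lia.
apply: le_trans (ler_pM _ _ h1 h2) _; do ?by rewrite prodr_ge0 // => *; apply: prob_ge0.
rewrite -!mulrA; apply: ler_wpM2l; first exact: prob_ge0.
rewrite [leRHS]mulrCA; apply: ler_wpM2l; first by apply: prodr_ge0 => *; apply: pow2_ge0.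
rewrite /prob /density pow2X -!pow2D pow2_le excessS -subr_ge0 !PoszM.
have -> : forall A B C D E F : int, - (A * B) + (C + A - D * E) * B - (C * F + - (D * B) * E) = C * (B - F).
  by move=> *; ring.
by rewrite mulr_ge0 ?excess_ge0 // subr_ge0 lez_nat.
Qed.

Lemma sum_scales (u : nat -> R) M K : (forall j, 0 <= u j) ->
  (forall j, (j < K)%N -> (Q ^ j)%N%:R * u j <= M) ->
  \sum_(x <- iota 1 (Q ^ K).-1) u (scale x) <= (K * Q)%N%:R * M.
Proof.
move=> u0; elim: K => [|K IH] h; first by rewrite big_nil mul0n mul0r.
have Q0 : (0 < Q ^ K)%N by rewrite expn_gt0 (ltnW Q_gt1).
have QS : (Q ^ K <= Q ^ K.+1)%N by rewrite leq_exp2l ?Q_gt1.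
have -> : ((Q ^ K.+1).-1 = (Q ^ K).-1 + (Q ^ K.+1 - Q ^ K))%N by lia.
rewrite iotaD big_cat mulSn natrD mulrDl [leRHS]addrC lerD //=; first
  by apply: IH => j jK; apply: h; apply: ltnW.
rewrite add1n prednK //.
have -> : \sum_(x <- iota (Q ^ K) (Q ^ K.+1 - Q ^ K)) u (scale x) =
          \sum_(x <- iota (Q ^ K) (Q ^ K.+1 - Q ^ K)) u K.
  rewrite big_seq [RHS]big_seq; apply: eq_bigr => x; rewrite mem_iota subnKC //.
  by move=> /scale_eq ->.
rewrite big_const_seq count_predT iter_addr_0 size_iota -[u K *+ _]mulr_natl.
apply: (@le_trans _ _ ((Q ^ K.+1)%N%:R * u K)).
  by rewrite ler_wpM2r // ler_nat leq_subr.
by rewrite expnS natrM -mulrA ler_wpM2l // h.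
Qed.

(** Conditions satisfied by every cube contained in the chosen set and whose
    largest element has scale [K]: the last one holds because either the base
    point or the largest step is comparable to the largest element. *)
Definition relevant (K : nat) (c : nat * seq nat) : bool :=
  [&& sorted geq c.2, uniq (cube c.1 c.2),
      all (fun x => scale x <= K)%N (cube c.1 c.2)
    & (scale c.1 == K) || (K.-1 <= scale (head 0 c.2))%N].

Definition cubes (K : nat) : seq (seq nat) :=
  let X := (Q ^ K.+1).-1 in
  [seq cube c.1 c.2 | c <- [seq (a, ds) | a <- iota 1 X, ds <- tuples r X]
                        & relevant K c].

(** If the largest step is large, [cube_weight] applies; if the base point is
    large, all the 2^r sums have probability 2^(-sK), and bounding each density
    below by Q^(-K) gives the same estimate. *)
Lemma relevant_weight K a ds : (0 < K)%N -> size ds = r -> excess r <= 0 ->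
  all (leq 1) ds -> relevant K (a, ds) ->
  \prod_(x <- cube a ds) prob (scale x) <=
    prob (scale a) * \prod_(d <- ds) density d * pow2 R (excess r * (K.-1)%:Z).
Proof.
move=> K0 szds ex ds1 /and4P[/= sds _ /allP le_scale /orP[/eqP aK|hd]]; last first.
  apply: le_trans (cube_weight _ _ _) _; rewrite ?szds //.
  rewrite ler_wpM2l ?pow2_le ?ler_wnM2l //.
  by rewrite mulr_ge0 ?prob_ge0 ?prodr_ge0 // => *; apply: pow2_ge0.
(* the base point has scale [K], hence so have all the sums *)
apply: (@le_trans _ _ (prob K ^+ (2 ^ r))).
  rewrite -szds -(size_cube a); apply: prod_le_const => x /cube_bounds/andP[ax _].
  by rewrite prob_ge0 -aK prob_le.
have dK : pow2 R (- (n * K)%N%:Z) ^+ r <= \prod_(d <- ds) density d.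
  rewrite -szds; apply: prod_ge_const => [|d dds]; first exact: pow2_ge0.
  rewrite /density pow2_le lerN2 lez_nat leq_mul2l; apply/orP; right.
  have ad : (d <= a + sumn ds)%N.
    by rewrite (leq_trans _ (leq_addl _ _)) // sumnE (big_rem d) //= leq_addr.
  exact: leq_trans (scale_le ad) (le_scale _ (mem_cube_top a ds)).
rewrite aK; apply: (@le_trans _ _ (prob K * pow2 R (- (n * K)%N%:Z) ^+ r *
    pow2 R (excess r * (K.-1)%:Z))); last first.
  by rewrite ler_wpM2r ?pow2_ge0 // ler_wpM2l ?prob_ge0.
rewrite /prob !pow2X -!pow2D pow2_le -subr_ge0.
have -> : (K.-1)%:Z = K%:Z - 1 by lia.
rewrite /excess in ex *; rewrite !PoszM.
have -> : forall S k N T P : int, - (S * k) + - (N * k) * T + (T * N - S * (P - 1)) * (k - 1) - - (S * k) * P = - (T * N - S * (P - 1)) by move=> *; ring.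
by rewrite oppr_ge0.
Qed.

Hypothesis s_le_n : (s <= n)%N.
Hypothesis excess_le0 : excess r <= 0.

(** The base point contributes Q^(K (1 - s/n)), which is also the order of the
    number of selected integers of scale [K]; the densities sum to a power of
    K.+1 <= 2^K, and the negative [excess r] makes the product small. *)
Lemma expected_cubes K : (0 < K)%N ->
  \sum_(S <- cubes K) \prod_(x <- S) prob (scale x) <=
    pow2 R ((r.+1 * (K.+1 + n) + (n - s) * K)%N%:Z + excess r * (K.-1)%:Z).
Proof.
move=> K0; rewrite /cubes big_map big_filter.
set X := (Q ^ K.+1).-1; set P := [seq _ | a <- _, ds <- _].
apply: (@le_trans _ _ (\sum_(c <- P) (prob (scale c.1) *
    \prod_(d <- c.2) density d * pow2 R (excess r * (K.-1)%:Z)))).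
  rewrite big_mkcond big_seq [leRHS]big_seq; apply: ler_sum => -[a ds] /=.
  move=> /allpairsP[[a' ds'] [/= ha +]] [-> ->] {a ds}.
  rewrite mem_tuples => /andP[/eqP szds /allP hds].
  case: ifP => rel; last first.
    by rewrite !mulr_ge0 ?pow2_ge0 ?prob_ge0 // prodr_ge0 // => *; apply: pow2_ge0.
  apply: relevant_weight => //; apply/allP => d /hds; lia.
rewrite big_allpairs_dep /=.
have -> : \sum_(a <- iota 1 X) \sum_(ds <- tuples r X)
    (prob (scale a) * \prod_(d <- ds) density d * pow2 R (excess r * (K.-1)%:Z)) =
  (\sum_(a <- iota 1 X) prob (scale a)) * (\sum_(d <- iota 1 X) density d) ^+ r *
    pow2 R (excess r * (K.-1)%:Z).
  rewrite -sum_tuples -mulrA [RHS]mulr_suml; apply: eq_bigr => a _.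
  by rewrite mulr_suml mulr_sumr; apply: eq_bigr => ds _; rewrite mulrA.
rewrite pow2D ler_wpM2r ?pow2_ge0 //.
have QE j : (Q ^ j)%N%:R = pow2 R (n * j)%N%:Z by rewrite -expnM pow2_nat.
have KQ : (K.+1 * Q)%N%:R <= pow2 R (K.+1 + n)%N%:Z.
  by rewrite pow2_nat ler_nat expnD leq_mul2r (ltnW (ltn_expl _ _)) ?orbT.
have sum_a : \sum_(a <- iota 1 X) prob (scale a) <=
    pow2 R (K.+1 + n)%N%:Z * pow2 R ((n - s) * K)%N%:Z.
  apply: le_trans (ler_wpM2r (pow2_ge0 _ _) KQ); apply: sum_scales => [j|j jK].
    exact: prob_ge0.
  rewrite QE /prob -pow2D pow2_le; nia.
have sum_d : \sum_(d <- iota 1 X) density d <= pow2 R (K.+1 + n)%N%:Z.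
  apply: le_trans KQ; rewrite -[leRHS]mulr1.
  apply: (@sum_scales (fun j => pow2 R (- (n * j)%N%:Z))) => [j|j jK].
    exact: pow2_ge0.
  by rewrite QE -pow2D subrr.
apply: le_trans (ler_pM _ _ sum_a (lerXn2r r _ _ sum_d)) _.
- by apply: sumr_ge0 => *; apply: prob_ge0.
- by rewrite exprn_ge0 // sumr_ge0 // => *; apply: pow2_ge0.
- by rewrite nnegrE sumr_ge0 // => *; apply: pow2_ge0.
- by rewrite nnegrE pow2_ge0.
rewrite pow2X -!pow2D pow2_le; lia.
Qed.
End Weights.

Local Close Scope ring_scope.

(** * An infinite cube-free set *)

(** [behrend] with cardinality a power of two, so that the set splits exactly
    into groups of 2^(sK) elements. *)
Lemma behrend_pow2 n w k : n + k <= w * (n - 2) -> 2 <= n ->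
  exists W : seq nat,
  [/\ uniq W, ap3_free (fun x => x \in W),
      forall x, x \in W -> x < 2 ^ (n * w.+1) & size W = 2 ^ k].
Proof.
move=> hk n2; have [W [uW W3 Wlt szW]] := behrend n w.
have le_sz : 2 ^ k <= size W.
  have pos : 0 < (n * 4 ^ w).+1 by [].
  rewrite -(leq_pmul2r pos); apply: leq_trans szW.
  apply: (@leq_trans (2 ^ k * 2 ^ (n + 2 * w))).
    rewrite leq_mul2l; apply/orP; right.
    rewrite expnD expnM (_ : 2 ^ 2 = 4) //.
    have := ltn_expl n (isT : 1 < 2); have : 0 < 4 ^ w by rewrite expn_gt0.
    by move: (4 ^ w) (2 ^ n) => A B; nia.
  rewrite -expnD leq_exp2l //; nia.
exists (take (2 ^ k) W); split.
- exact: take_uniq.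
- by move=> x y z /mem_take hx /mem_take hy /mem_take hz; apply: W3.
- by move=> x /mem_take; apply: Wlt.
- by rewrite size_takel.
Qed.

Section Construction.
Variables n s r K0 : nat.
Local Notation Q := (2 ^ n).
Local Notation scale := (scale n).

(** A progression-free set of 2^(K.-1 (n - 2) - n) elements is divided into
    groups of 2^(sK); one element is selected in each group. *)
Definition log_size (K : nat) : nat := K.-1 * (n - 2) - n - s * K.

Hypothesis n_ge3 : 2 < n.
Hypothesis r_le : r <= Q.
Hypothesis K0_gt0 : 0 < K0.
Hypothesis s_le_n : s <= n.
Hypothesis excess_ge0 : forall t, t < r -> (0 <= excess n s t)%R.
Hypothesis excess_le0 : (excess n s r <= 0)%R.
Hypothesis room : forall K, K0 <= K -> n + s * K <= K.-1 * (n - 2).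
(* the expected number of cubes is at most 2^-(K+2) times the size of the block,
   which is summable with sum at most 1/2 *)
Hypothesis slack : forall K, K0 <= K ->
  ((r.+1 * (K.+1 + n) + (n - s) * K)%N%:Z + excess n s r * (K.-1)%:Z
     <= - (K.+2)%:Z + (log_size K)%:Z)%R.

(** The interval is short compared with its distance to the origin and to the
    other blocks, which excludes progressions across blocks. *)
Definition block (K : nat) (V : seq nat) : Prop :=
  ap3_free (fun x => x \in V) /\ forall x, x \in V -> 4 * Q ^ K <= x < 5 * Q ^ K.

(** Below the scale [K0], where the size estimates fail, the block is empty. *)
Definition block_family (K : nat) (V : seq nat) (fam : seq (seq nat)) : Prop :=
  [/\ block K V, fam != [::],
      forall F, F \in fam -> [/\ uniq F, {subset F <= V} &
        size F = if K0 <= K then 2 ^ log_size K else 0]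
    & forall S, uniq S ->
      (\sum_(F <- fam) (all (mem F) S)%:R <=
         prob rat s K ^+ size S * (size fam)%:R :> rat)%R].

Lemma block_familyP K : exists Vf, block_family K Vf.1 Vf.2.
Proof.
have [hK|hK] := leqP K0 K; last first.
  exists ([::], [:: [::]]); split=> //=.
  - by move=> F; rewrite inE => /eqP->; rewrite leqNgt hK.
  - move=> S _; rewrite big_seq1 mulr1; case: S => [|x S] /=; first by rewrite expr0.
    by rewrite exprn_ge0 // prob_ge0.
have Kpos : 0 < K by apply: leq_trans hK.
pose m := 2 ^ log_size K; pose g := 2 ^ (s * K).
have [|//|W [uW W3 Wlt szW]] := @behrend_pow2 n K.-1 (log_size K + s * K).
- by have := room hK; rewrite /log_size; lia.
- exact: ltnW.
have {}szW : size W = m * g by rewrite szW expnD.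
pose V := [seq 4 * Q ^ K + x | x <- W].
have uV : uniq V by rewrite map_inj_uniq // => x y /addnI.
have szV : size V = m * g by rewrite size_map.
pose e (ic : 'I_m * 'I_g) := nth 0 V (ic.1 * g + ic.2).
have g0 : 0 < g by rewrite expn_gt0.
have lt_sz (ic : 'I_m * 'I_g) : ic.1 * g + ic.2 < size V.
  by rewrite szV; case: ic => -[i hi] [c hc] /=; nia.
have e_inj : injective e.
  move=> [i c] [j d] /eqP; rewrite /e nth_uniq ?lt_sz //= => /eqP E.
  have := congr1 (divn ^~ g) E; have := congr1 (modn ^~ g) E.
  rewrite /= !divnMDl // !modnMDl !modn_small // !divn_small // !addn0.
  by move=> cd ij; congr (_, _); apply: val_inj.
exists (V, transversals e); split=> /=.
- split.
    move=> _ _ _ /mapP[x hx ->] /mapP[y hy ->] /mapP[z hz ->] E.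
    by congr (_ + _); apply: (W3 _ _ z) => //; lia.
  move=> _ /mapP[x /Wlt hx ->]; rewrite prednK // in hx.
  rewrite leq_addr /= -expnM; lia.
- by rewrite -size_eq0 size_transversals -lt0n expn_gt0 card_ord g0.
- move=> F /mapP[f _ ->]; split.
  + exact: uniq_transversal.
  + by move=> _ /mapP[i _ ->]; apply/mem_nth/lt_sz.
  + by rewrite size_transversal card_ord hK.
move=> S uS; have := count_transversals e_inj uS.
rewrite card_ord => le_nat.
rewrite /prob pow2X mulNr -PoszM mulrC /pow2 -exprnN ler_pdivlMr ?exprn_gt0 //.
apply: le_trans (_ : _ <= (count (fun F => all (mem F) S) (transversals e)
  * g ^ size S)%N%:R)%R _; last by rewrite ler_nat.
rewrite natrM -sum1_count natr_sum -expnM natrX.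
rewrite ler_wpM2r ?exprn_ge0 //.
by rewrite [leRHS]big_mkcond; apply: ler_sum => F _; case: all.
Qed.

Lemma block_ltS J K V x : block J V -> x \in V -> J < K -> 8 * x < 5 * Q ^ K.
Proof.
move=> [_ hV] /hV /andP[_ hx] JK.
have : Q ^ J * 8 <= Q ^ K.
  apply: leq_trans (_ : Q ^ J.+1 <= _); last by rewrite leq_exp2l ?Q_gt1.
  by rewrite expnSr leq_mul2l Q_ge8 ?orbT.
lia.
Qed.

(** Let z be the largest term of a progression x, y, z. Then y >= z / 2 lies in
    the block of z, and x = 2y - z is too large to lie in a lower block. *)
Lemma ap3_free_blocks (V : nat -> seq nat) : (forall K, block K (V K)) ->
  ap3_free (fun x => exists K, x \in V K).
Proof.
move=> hV.
have half x y z : forall I J K, x \in V I -> y \in V J -> z \in V K ->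
    I <= K -> x + z = y.*2 -> x = y.
  move=> I J K hx hy hz IK E.
  have [V3 bK] := hV K; have /andP[z1 z2] := bK _ hz.
  have JK : J = K.
    case: (ltngtP J K) => // JK; first by have := block_ltS (hV J) hy JK; lia.
    have := block_ltS (hV K) hz JK; have /andP[] := (hV J).2 _ hy.
    by have := block_ltS (hV I) hx (leq_ltn_trans IK JK); lia.
  rewrite {}JK in hy; have /andP[y1 y2] := bK _ hy.
  have IK' : I = K.
    have [IlK|] := ltnP I K; last by lia.
    by have := block_ltS (hV I) hx IlK; lia.
  by rewrite {}IK' in hx; apply: (V3 x y z).
move=> x y z [I hx] [J hy] [K hz] E.
have [IK|KI] := leqP I K; first exact: (half x y z I J K).
have := half z y x K J I hz hy hx (ltnW KI); lia.
Qed.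

Lemma scale_block K V x : block K V -> x \in V -> scale x = K.
Proof.
move=> [_ h] /h hx; apply: scale_eq => //; rewrite expnS.
by have := Q_ge8 n_ge3; nia.
Qed.

Lemma last_cube y a ds : last y (cube a ds) = a + sumn ds.
Proof.
elim: ds y a => [|d ds IH] y a /=; first by rewrite addn0.
by rewrite last_cat IH addnA.
Qed.

Lemma sum_geometric L :
  (\sum_(0 <= K < L) pow2 rat (- (K.+2)%:Z) <= 2^-1 :> rat)%R.
Proof.
suff -> : (\sum_(0 <= K < L) pow2 rat (- (K.+2)%:Z) =
           2^-1 - pow2 rat (- (L.+1)%:Z) :> rat)%R.
  by rewrite gerBl pow2_ge0.
elim: L => [|L IH]; first by rewrite big_nil /pow2 -exprnN expr1 subrr.
rewrite big_nat_recr //= IH /pow2 -!exprnN [(2 ^+ L.+2)%R]exprS invfM.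
by field; rewrite expf_neq0.
Qed.

(** The largest element a + sum of the steps is at least 4 Q^K; if [a] lies in
    a lower block, then the sum of the [r <= Q] steps exceeds Q^K, and the
    largest step is at least Q^(K-1). *)
Lemma relevant_cube (V : nat -> seq nat) a ds :
  (forall K, block K (V K)) -> 0 < a -> all (leq 1) ds -> size ds = r ->
  sorted geq ds -> (forall x, x \in cube a ds -> x \in V (scale x)) ->
  cube a ds \in cubes n r (scale (a + sumn ds)).
Proof.
move=> hV a0 ds1 szds sds inV; set K := scale (a + sumn ds).
have topV : a + sumn ds \in V K by apply: inV; apply: mem_cube_top.
have ltX x : x <= a + sumn ds -> x <= (Q ^ K.+1).-1.
  move=> hx; have := @scale_lt n n_ge3 (a + sumn ds) K (leqnn _); lia.
apply/mapP; exists (a, ds) => //; rewrite mem_filter; apply/andP; split; last first.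
  apply/allpairsP; exists (a, ds); split=> //=.
    by rewrite mem_iota a0 add1n ltnS ltX // leq_addr.
  rewrite mem_tuples szds eqxx /=; apply/allP => d dds.
  rewrite (allP ds1 _ dds) ltX // (leq_trans _ (leq_addl _ _)) //.
  by rewrite sumnE (big_rem d) //= leq_addr.
apply/and4P; split=> //=.
- apply: (uniq_cube (ap3_free_blocks hV)) => // x xc.
  by exists (scale x); apply: inV.
- by apply/allP => x /cube_bounds/andP[_ hx]; apply: scale_le.
have [//|aK] := eqVneq (scale a) K.
have ltK : scale a < K by rewrite ltn_neqAle aK scale_le // leq_addr.
have K1 : 0 < K by apply: leq_ltn_trans ltK.
have a_small := block_ltS (hV _) (inV _ (mem_cube_base a ds)) ltK.
have /andP[top_big _] := (hV K).2 _ topV.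
have sum_le : sumn ds <= r * head 0 ds.
  rewrite -szds; case: (ds) sds => //= d ds' pd.
  have /allP h : all (geq d) ds' by apply: order_path_min pd => x y z; rewrite /geq /=; lia.
  rewrite mulSn leq_add2l sumnE -sum1_size big_distrl /= big_seq [leqRHS]big_seq.
  by apply: leq_sum => x /h; rewrite mul1n.
rewrite leqNgt; apply/negP => hd.
have hd2 : head 0 ds < Q ^ K.-1.
  have := @scale_lt n n_ge3 (head 0 ds) K.-2; rewrite prednK; last lia.
  by apply; lia.
have QK : Q ^ K = Q * Q ^ K.-1 by rewrite -expnS prednK.
have : r * head 0 ds <= Q * Q ^ K.-1 by apply: leq_mul => //; apply: ltnW.
rewrite -QK; lia.
Qed.

(** The choices provided by [derandomisation], with weights one over the size of
    the block, contain at each scale at most half as many cubes as elements;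
    the set [C] is what remains after deleting the largest element of each of
    these cubes. *)
Lemma cube_free_set : exists C : nat -> Prop,
  [/\ forall x, C x -> 0 < x,
      forall a ds, size ds = r -> sorted geq ds -> all (leq 1) ds ->
        ~ (forall x, x \in cube a ds -> C x)
    & forall K, K0 <= K -> exists F : seq nat,
        [/\ uniq F, 2 ^ log_size K <= 2 * size F &
            forall x, x \in F -> C x /\ scale x = K]].
Proof.
have [Vf hVf] := choice block_familyP.
pose V K := (Vf K).1.
have hV K : block K (V K) by have [] := hVf K.
pose w K : rat := if K0 <= K then pow2 rat (- (log_size K)%:Z) else 0%R.
have [|||||||F [Ff Fbad]] := @derandomisation rat (fun K => (Vf K).2) scale
  (prob rat s) w (cubes n r) (2^-1)%R.
- by move=> K; apply: prob_ge0.
- by move=> K; rewrite /w; case: ifP => // _; apply: pow2_ge0.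
- by move=> K; have [] := hVf K.
- by move=> K S uS _; have [_ _ _] := hVf K; apply.
- move=> K _ /mapP[c + ->]; rewrite mem_filter => /andP[/and4P[_ + _ _] _]; exact.
- move=> K _ x /mapP[c + ->].
  by rewrite mem_filter => /andP[/and4P[_ _ /allP h _] _] /h.
- move=> L; apply: le_trans (sum_geometric L); apply: ler_sum => K _.
  rewrite /w; have [hK|hK] := leqP K0 K; last by rewrite mul0r pow2_ge0.
  have Kpos : 0 < K by apply: leq_trans hK.
  apply: le_trans (ler_wpM2l (pow2_ge0 _ _) (expected_cubes rat n_ge3 excess_ge0 s_le_n excess_le0 Kpos)) _.
  by rewrite -pow2D pow2_le; have := slack hK; lia.
(* the last entry of the list [cube a ds] is its largest element *)
pose tops K := [seq last 0 c | c <- cubes n r K & all (fun x => x \in F (scale x)) c].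
have inV x : x \in F (scale x) -> x \in V (scale x).
  by have [_ _ /(_ _ (Ff (scale x)))[_ h _] _] := hVf (scale x); apply: h.
exists (fun x => x \in F (scale x) /\ x \notin tops (scale x)); split.
- move=> x [/inV xV _]; have /andP[+ _] := (hV _).2 _ xV.
  by apply: leq_trans; rewrite muln_gt0 !expn_gt0.
- move=> a ds szds sds ds1 inC.
  have inF x : x \in cube a ds -> x \in F (scale x) by move=> /inC[].
  have a0 : 0 < a.
    have /andP[+ _] := (hV _).2 _ (inV _ (inF _ (mem_cube_base a ds))).
    by apply: leq_trans; rewrite muln_gt0 !expn_gt0.
  have [_ /negP] := inC _ (mem_cube_top a ds); apply.
  apply/mapP; exists (cube a ds); last by rewrite last_cube.
  rewrite mem_filter; apply/andP; split; first by apply/allP => x; apply: inF.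
  by apply: (relevant_cube hV) => // x /inF /inV.
move=> K hK.
have [_ _ /(_ _ (Ff K))[uF sFV szF] _] := hVf K; rewrite hK in szF.
have scF x : x \in F K -> scale x = K by move=> /sFV; apply: scale_block (hV K).
exists [seq x <- F K | x \notin tops K]; split.
- exact: filter_uniq.
- have le_tops : 2 * size (tops K) <= 2 ^ log_size K.
    rewrite size_map size_filter -(ler_nat rat) natrM.
    have := Fbad K; rewrite /w hK => h.
    rewrite -pow2_nat -ler_pdivlMl // -[leLHS]mul1r.
    rewrite -[X in (X * _ <= _)%R](@mulfV _ (pow2 rat (log_size K)%:Z)) ?gt_eqF ?pow2_gt0 //.
    rewrite mulrAC [leRHS]mulrC -mulrA ler_wpM2l ?pow2_ge0 //.
    by apply: le_trans h; rewrite /pow2 -exprnN mulrC.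
  have : count (mem (tops K)) (F K) <= size (tops K).
    rewrite -size_filter uniq_leq_size ?filter_uniq // => x.
    by rewrite mem_filter => /andP[].
  rewrite size_filter; have := count_predC (mem (tops K)) (F K).
  rewrite szF; set A := count _ _; set B := count _ _.
  by move: A B => A B; lia.
- move=> x; rewrite mem_filter => /andP[xt xF]; have xK := scF _ xF.
  by rewrite xK.
Qed.
End Construction.

(** * Choice of the parameters *)

(** The ratio t / (2^t - 1) is strictly decreasing; here without division, the
    difference of the cross products being a positive integer. *)
Lemma mersenne_ratio_lt t r : 1 <= t < r ->
  r * (2 ^ t - 1) + 1 <= t * (2 ^ r - 1).
Proof.
elim: r => [|r IH]; first by lia.
case/andP=> t1; rewrite ltnS leq_eqVlt => /orP[/eqP <-|tr].
  by have := ltn_expl t (isT : 1 < 2); rewrite expnS; nia.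
have := IH (introT andP (conj t1 tr)).
have : 0 < 2 ^ r by rewrite expn_gt0.
have : 0 < 2 ^ t by rewrite expn_gt0.
rewrite expnS; move: (2 ^ t) (2 ^ r) => A B; nia.
Qed.

(** The selection exponent s/n is r / (2^r - 1) up to O(1/n). It is slightly
    larger, so that [excess n s r] is at most -(r + 5), which absorbs the powers
    of 2^K lost in [expected_cubes] and in the progression-free sets; for large
    n it stays below t / (2^t - 1) for every t < r by [mersenne_ratio_lt]. *)
Lemma parameters (R : realType) (r : nat) (eps : R) : 2 <= r -> (0 < eps)%R ->
  exists n s K0,
    [/\ [/\ 2 < n, r <= 2 ^ n, 0 < K0 & s.+2 < n],
        forall t, t < r -> (0 <= excess n s t)%R,
        (excess n s r <= 0)%R,
        forall K, K0 <= K -> n + s * K <= K.-1 * (n - 2) /\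
          ((r.+1 * (K.+1 + n) + (n - s) * K)%N%:Z + excess n s r * (K.-1)%:Z
             <= - (K.+2)%:Z + (log_size n s K)%:Z)%R
      & (1 - r%:R / (2 ^+ r - 1) - eps <= (n - 2 - s)%N%:R / n%:R :> R)%R].
Proof.
move=> r2 e0; pose M := 2 ^ r - 1.
have [M3 rM] : 3 <= M /\ 3 * r <= 2 * M.
  have : 4 <= 2 ^ r /\ 3 * r + 2 <= 2 * 2 ^ r.
    elim: r r2 {M} => // -[|[|r]] // IH _.
    by have := IH isT; rewrite (expnS 2 r.+2); lia.
  rewrite /M; lia.
pose B := Num.bound ((r + 5 + 3 * M)%N%:R / eps)%R.
have hB : ((r + 5 + 3 * M)%N%:R <= B%:R * eps)%R.
  by rewrite -ler_pdivrMr // ltW // archi_boundP // divr_ge0 // ltW.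
pose n := B + (r + 5 + M) * M + 3 * (r + 5 + M) + 7 + r.
pose s := (r * n + r + 5) %/ M + 1.
have [s1 s2] : r * n + r + 5 <= s * M /\ s * M <= r * n + r + 5 + M.
  have := divn_eq (r * n + r + 5) M; have := ltn_pmod (r * n + r + 5) (ltnW (ltnW M3)).
  by rewrite /s; move: (_ %/ M) (_ %% M) => q t; nia.
have nB : B <= n by rewrite /n; lia.
have nM : (r + 5 + M) * M + r <= n by rewrite /n; lia.
have nl : 3 * (r + 5 + M) + 7 <= n by rewrite /n; lia.
move: n s s1 s2 nB nM nl => n s s1 s2 nB nM nl.
have sn : s.+2 < n.
  have h1 : 3 * r * n <= 2 * M * n by rewrite leq_mul2r rM orbT.
  rewrite ltnNge; apply/negP => ns.
  have h2 : n * M <= s.+2 * M by rewrite leq_mul2r ns orbT.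
  have h3 : (3 * (r + 5 + M) + 7) * M <= n * M by rewrite leq_mul2r nl orbT.
  have h4 : r <= r * M by rewrite leq_pmulr // (ltnW (ltnW M3)).
  move: (M) M3 h1 h2 h3 h4 s2 => m; lia.
exists n, s, ((r.+1) * (1 + n) + r + 6 + 2 * n).
have excessE t : (excess n s t = (t * n)%N%:Z - (s * (2 ^ t - 1))%N%:Z)%R.
  rewrite /excess !PoszM; congr (_ - _ * _)%R.
  by have : 0 < 2 ^ t; [rewrite expn_gt0|lia].
split.
- split=> //; try lia.
  by apply: leq_trans (ltnW (ltn_expl n _)); lia.
- case=> [|t] tr; first by rewrite excessE; lia.
  have := @mersenne_ratio_lt t.+1 r; rewrite tr => /(_ isT).
  have tM : 2 ^ t.+1 - 1 <= M by rewrite /M leq_sub2r // leq_exp2l // ltnW.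
  have p0 : 0 < 2 ^ t.+1 by rewrite expn_gt0.
  rewrite -/M => h; suff : s * (2 ^ t.+1 - 1) <= t.+1 * n by rewrite excessE; lia.
  move: (2 ^ t.+1 - 1) tM h => A tM h.
  rewrite -(leq_pmul2r (ltnW (ltnW M3))) mulnAC.
  apply: (leq_trans (leq_mul s2 (leqnn A))).
  apply: (@leq_trans ((r * A + 1) * n)).
    have : (r + 5 + M) * A <= (r + 5 + M) * M by rewrite leq_mul2l tM orbT.
    by move: (M) nM => m nM; lia.
  by rewrite [leqRHS]mulnAC leq_mul2r h orbT.
- by rewrite excessE -/M; lia.
- move=> [|K] hK; first by lia.
  have [b bE] : exists b, n = s + 3 + b by exists (n - s - 3); lia.
  have [d dE] : exists d, s * M = r * n + (r + 5) + d.
    by exists (s * M - (r * n + r + 5)); lia.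
  have hn : n + s * K.+1 <= K * (n - 2).
    rewrite (_ : n - 2 = s + 1 + b); last by lia.
    by have : 0 <= K * b by []; lia.
  split=> //; rewrite excessE -/M dE /log_size /=.
  have -> : Posz (K * (n - 2) - n - s * K.+1) =
      ((K * (s + 1 + b))%N%:Z - n%:Z - (s * K.+1)%N%:Z)%R.
    by rewrite (_ : n - 2 = s + 1 + b) in hn *; lia.
  rewrite (_ : n - s = 3 + b); last by lia.
  have : 0 <= d * K by [].
  clear -hK bE; lia.
have n0 : (0 < n%:R :> R)%R by rewrite ltr0n; lia.
have M0 : (0 < M%:R :> R)%R by rewrite ltr0n; lia.
have M1 : (1 <= M%:R :> R)%R by rewrite ler1n; lia.
have -> : (2 ^+ r - 1 = M%:R :> R)%R by rewrite /M natrB ?expn_gt0 // natrX.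
have h1 : (s%:R * M%:R <= r%:R * n%:R + (r%:R + 5 + M%:R) :> R)%R.
  by rewrite -!natrM -!natrD ler_nat; lia.
have h2 : (r%:R + 5 + 3 * M%:R <= n%:R * eps)%R.
  rewrite -natrM -!natrD; apply: le_trans hB _; by rewrite ler_wpM2r ?ler_nat // ltW.
have h3 : ((n - 2 - s)%N%:R + s%:R + 2 = n%:R :> R)%R.
  by rewrite -!natrD; congr _%:R%R; lia.
rewrite ler_pdivlMr // -(ler_pM2r M0).
move: h1 h2 h3 n0 M0 M1; move: (n%:R : R)%R (M%:R : R)%R (s%:R : R)%R ((n - 2 - s)%:R : R)%R (r%:R : R)%R => N m S E p h1 h2 h3 n0 M0 M1.
have -> : ((1 - p / m - eps) * N * m = N * m - p * N - N * eps * m)%R.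
  by field; rewrite gt_eqF.
have h4 : (N * eps <= N * eps * m)%R by rewrite ler_peMr // mulr_ge0 // ltW.
have -> : (E = N - S - 2)%R by rewrite -h3; ring.
lra.

Qed.

(** * From natural numbers to sets of integers *)

Lemma cube_subset_sum (I : eqType) (D : I -> nat) (idx : seq I) a v :
  uniq idx -> v \in cube a (map D idx) ->
  exists J : pred I, v = a + \sum_(i <- idx | J i) D i.
Proof.
elim: idx a => [|i idx IH] a /=.
  by rewrite inE => _ /eqP->; exists pred0; rewrite big_nil addn0.
case/andP=> iis uis; rewrite mem_cat => /orP[] /(IH _ uis)[J ->].
  exists (fun j => J j && (j != i)); rewrite big_cons eqxx andbF; congr (_ + _).
  rewrite big_seq_cond [RHS]big_seq_cond; apply: eq_bigl => j.
  by have [->|] := eqVneq j i; rewrite ?andbT // (negPf iis).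
exists (fun j => J j || (j == i)); rewrite big_cons eqxx orbT -addnA.
congr (_ + (_ + _)); rewrite big_seq_cond [RHS]big_seq_cond; apply: eq_bigl => j.
by have [->|] := eqVneq j i; rewrite ?orbF // (negPf iis).
Qed.

Lemma two_element_fset (X : {fset int}) : #|` X|%fset = 2 ->
  exists x d, [/\ 0 < d, x \in X & (x + Posz d)%R \in X].
Proof.
move=> X2; have : size X = 2 by rewrite -X2.
have := fset_uniq X; case E : (X : seq int) => [|x [|y [|? ?]]] //=.
rewrite inE andbT => xy _.
have hx : x \in X by rewrite -[x \in X]/(x \in (X : seq int)) E mem_head.
have hy : y \in X by rewrite -[y \in X]/(y \in (X : seq int)) E !inE eqxx orbT.
have [lt|le] := ltP x y.
  exists x, `|y - x|%N; split=> //; first by lia.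
  by rewrite (_ : (_ + _)%R = y) //; lia.
exists y, `|x - y|%N; split=> //; first by lia.
by rewrite (_ : (_ + _)%R = x) //; lia.
Qed.

Definition int_set (C : nat -> Prop) : set int :=
  [set z : int | exists2 x : nat, C x & z = Posz x]%classic.

Lemma int_setE C (x : nat) : int_set C (Posz x) -> C x.
Proof. by case=> y Cy [->]. Qed.

(** Writing each two-element set as {x, x + D} with D > 0, the sumset is the
    cube with base point the sum of the x and steps the D; the base point is
    itself in the set, hence a natural number. *)
Lemma int_set_cube_free (r : nat) (C : nat -> Prop) :
  (forall a ds, size ds = r -> sorted geq ds -> all (leq 1) ds ->
    ~ (forall x, x \in cube a ds -> C x)) ->
  hilbert_cube_free r (int_set C).
Proof.
move=> Cfree L L2 LC.
have [x hx] := choice (fun i => two_element_fset (L2 i)).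
have {hx}[D hD] := choice hx.
have sumC (J : pred 'I_r) :
    int_set C (\sum_(i < r) x i + (\sum_(i < r | J i) D i)%N%:Z)%R.
  apply: LC; exists (fun i => if J i then x i + (D i)%:Z else x i)%R; split.
    by move=> i; have [_ h1 h2] := hD i; case: ifP.
  rewrite -[Posz (\sum_(_ < _ | _) _)]natz natr_sum [X in (_ + X)%R]big_mkcond -big_split /=.
  by apply: eq_bigr => i _; case: ifP; rewrite ?addr0 // natz.
have [a _ aE0] := sumC pred0.
have aE : (\sum_(i < r) x i)%R = Posz a.
  by move: aE0; rewrite [X in Posz X]big_pred0 //; lia.
rewrite aE in sumC.
pose idx := sort (fun i j => geq (D i) (D j)) (enum 'I_r).
apply: (Cfree a (map D idx)).
- by rewrite size_map size_sort size_enum_ord.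
- rewrite sorted_map; apply: sort_sorted => i j; rewrite /geq /=; exact: leq_total.
- by apply/allP => _ /mapP[i _ ->]; have [] := hD i.
move=> v /cube_subset_sum[|J ->]; first by rewrite sort_uniq enum_uniq.
rewrite (perm_big (enum 'I_r)) /=; last by rewrite perm_sort.
by rewrite big_enum_cond; apply: int_setE; rewrite PoszD.
Qed.

Local Open Scope classical_set_scope.
Local Open Scope ring_scope.

Lemma le_counting (R : realType) (C : nat -> Prop) (F : seq nat) (x : R) :
  uniq F -> (forall y, y \in F -> [/\ C y, (0 < y)%N & y%:R <= x]) ->
  (size F <= counting (int_set C) x)%N.
Proof.
move=> uF hF.
have [x0|x0] := ltP x 0.
  case: F uF hF => // y F _ h; have [_ _ yx] := h y (mem_head y F).
  by have := le_lt_trans yx x0; rewrite ltrn0.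
have fin : finite_set (int_set C `&` [set n : int | (1 : R) <= n%:~R <= x])%classic.
  apply: (@sub_finite_set _ _ [set` [seq Posz y | y <- iota 0 (Num.truncn x).+1]]%classic) => //.
  move=> _ [[y _ ->] /andP[_ yx]]; apply: (@map_f _ _ Posz).
  by rewrite mem_iota add0n ltnS truncn_ge_nat.
rewrite /counting -(size_map Posz) uniq_leq_size //.
  by rewrite map_inj_uniq // => y z [].
move=> _ /mapP[y yF ->]; have [Cy y0 yx] := hF y yF.
by rewrite in_fset_set // inE; split; [exists y|rewrite /= ler1n y0].
Qed.

Theorem theorem7 (R : realType) (r : nat) (hr : (2 <= r)%N)
    (eps : R) (heps : 0 < eps) :
  exists A : set int,
    [/\ A `<=` [set n : int | 0 < n],
        infinite_set A,
        hilbert_cube_free r A &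
        exists c x0 : R, 0 < c /\
          forall x : R, x0 <= x ->
            c * x `^ (1 - r%:R / (2 ^+ r - 1) - eps) <= (counting A x)%:R].
Proof.
have [n [s [K0 [[n3 rn K0pos sn] ex_ge0 ex_le0 hK0 expo]]]] := parameters hr heps.
have s_le_n : (s <= n)%N by lia.
have [C [Cpos Cfree Cbig]] := cube_free_set n3 rn K0pos s_le_n ex_ge0 ex_le0
  (fun K h => (hK0 K h).1) (fun K h => (hK0 K h).2).
have Q1 := Q_gt1 n3.
exists (int_set C); split.
- by move=> _ [x Cx ->] /=; rewrite ltz_nat; apply: Cpos.
- move=> /finite_seqP[X XE].
  pose B := (\max_(z <- X) `|z|)%N.
  have [|F [uF szF hF]] := Cbig (maxn K0 B); first by rewrite leq_maxl.
  have F0 : (0 < size F)%N by have : (0 < 2 ^ log_size n s (maxn K0 B))%N; [rewrite expn_gt0|lia].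
  have [Cx xK] := hF _ (mem_nth 0%N F0).
  set x := nth _ _ _ in Cx xK.
  have xX : x%:Z \in X.
    have : int_set C x%:Z by exists x.
    by rewrite XE.
  have xB : (x <= B)%N by rewrite -[x]/(`|x%:Z|%N); apply: leq_bigmax_seq.
  have := trunc_logP Q1 (Cpos _ Cx); rewrite -/(scale n x) xK.
  have := ltn_expl (maxn K0 B) Q1; have := leq_maxr K0 B; lia.
- exact: int_set_cube_free.
(* [b / n] is the exponent reached; the constant compares the block at scale [K]
   with the bound Q^(K+2) on [x], since [log_size n s K] is [b K] up to O(n) *)
pose b := (n - 2 - s)%N.
exists (2 ^+ (2 * b + 2 * n - 1))^-1, (2 ^ (n * K0.+1))%N%:R; split.
  by rewrite invr_gt0 exprn_gt0.
move=> x hx.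
have x1 : 1 <= x by apply: le_trans hx; rewrite ler1n expn_gt0.
have x0 : 0 <= x by apply: le_trans x1.
pose N := Num.truncn x.
have N0 : (0 < N)%N by rewrite truncn_gt0.
have [K NK] : exists K, scale n N = K.+1.
  exists (scale n N).-1; rewrite prednK //; apply: (@leq_trans K0.+1) => //.
  apply: trunc_log_max => //; rewrite -expnM truncn_ge_nat //.
have hK : (K0 <= K)%N.
  rewrite -ltnS -NK; apply: trunc_log_max => //; by rewrite -expnM truncn_ge_nat.
have [F [uF szF hF]] := Cbig K hK.
have szC : (size F <= counting (int_set C) x)%N.
  apply: le_counting => // y /hF[Cy yK]; split=> //; first exact: Cpos.
  rewrite -truncn_ge_nat // -/N.
  have := scale_lt n3 (eq_leq yK); have := trunc_logP Q1 N0.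
  by rewrite -/(scale n N) NK => h1 h2; apply: ltnW; apply: leq_trans h1.
have xK : x <= 2 `^ (n * K.+2)%N%:R.
  rewrite powR_mulrn // -natrX expnM ltW // (lt_le_trans (truncnS_gt x)) // ler_nat.
  by have := @scale_lt n n3 N K.+1; rewrite NK => /(_ (leqnn _)).
have n0 : n%:R != 0 :> R by rewrite pnatr_eq0; lia.
have xe : x `^ (1 - r%:R / (2 ^+ r - 1) - eps) <= 2 ^+ (b * K.+2).
  apply: le_trans (ler_powR x1 expo) _.
  apply: (@le_trans _ _ ((2 `^ (n * K.+2)%N%:R) `^ (b%:R / n%:R))).
    by apply: ge0_ler_powR; rewrite ?nnegrE ?divr_ge0 ?powR_ge0.
  rewrite -powRrM -powR_mulrn // natrM natrM.
  by rewrite (_ : _ * (b%:R / _) = b%:R * K.+2%:R) //; field.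
rewrite ler_pdivrMl ?exprn_gt0 //; apply: le_trans xe _.
apply: (@le_trans _ _ ((2 ^ (2 * b + 2 * n - 1))%N%:R * (size F)%:R)); last first.
  by rewrite natrX ler_wpM2l ?exprn_ge0 // ler_nat.
rewrite -natrM -natrX ler_nat.
have -> : (b * K.+2 = (2 * b + 2 * n - 2) + log_size n s K)%N.
  have [h _] := hK0 K hK; have Kpos : (0 < K)%N by lia.
  rewrite /log_size; move: h; rewrite (_ : n - 2 = b + s)%N; last by rewrite /b; lia.
  case: K Kpos {hK NK szF hF xK} => // K _ /=; rewrite /b; nia.
have -> : (2 * b + 2 * n - 1 = (2 * b + 2 * n - 2).+1)%N by lia.
by rewrite expnD expnS -mulnA mulnCA leq_mul2l szF orbT.
Qed.
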